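(* Let $G$ be a finite connected graph with a colouring $\omega: V(G)\to C$ (not necessarily proper) from a colour-set $C$, and let $\mathcal{T}(G)$ denote the set of all spanning trees of $G$. Then, for every $d \in C$, $$m_G(G,\omega,d) = \min_{T \in \mathcal{T}(G)} m_T(T,\omega,d).$$
   Context: Flood-filling game: a graph $G=(V,E)$ carries a colouring $\omega:V\to C$ (not necessarily proper). A move $(v,d)$ with $v\in V$, $d\in C$ gives colour $d$ to every vertex of the monochromatic component of $v$ (the maximal connected set of vertices containing $v$ all having the same colour as $v$). Moves may be played at any vertex. $m_G(G,\omega,d)$ denotes the minimum number of moves that, played in $G$ starting from $\omega$, make every vertex of $G$ have colour $d$. For a spanning tree $T$ of $G$, $m_T(T,\omega,d)$ is the same quantity for the game played on the tree $T$ alone (with the same initial colouring), where monochromatic components are computed in $T$. *)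

(* Defs.v *)
From HB Require Import structures.
From mathcomp Require Import all_boot.
From mathcomp Require Import boolp.

Set Implicit Arguments.
Unset Strict Implicit.
Unset Printing Implicit Defensive.

Record sgraph (V : finType) := SGraph {
  adj :> rel V;
  adj_sym : symmetric adj;
  adj_irrefl : irreflexive adj }.

Section Graphs.

Variable V : finType.
Implicit Types (G T : sgraph V) (S : {set V}).

Definition connected_graph G := forall x y : V, connect G x y.

(* An edge traversed back and forth is a ucycle of size 2 and must be allowed. *)
Definition acyclic_graph G := forall c : seq V, ucycle G c -> size c <= 2.

Definition is_tree G := connected_graph G /\ acyclic_graph G.

(* T lives on the same vertex type as G, so any such subgraph is spanning. *)
Definition spanning_tree G T := subrel T G /\ is_tree T.

(* S induces a connected subgraph of G. *)
Definition connected_set G S :=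
  [forall x in S, forall y in S,
     connect [rel a b | [&& a \in S, b \in S & G a b]] x y].

End Graphs.

Section FloodFilling.

Variables (V : finType) (C : eqType).
Implicit Types (G : sgraph V) (w : {ffun V -> C}) (v : V) (d : C).

Definition mono_component G w v : {set V} :=
  [set u | connect [rel a b | G a b && (w a == w b)] v u].

Definition mono_connected G w v (S : {set V}) :=
  [&& v \in S, [forall u in S, w u == w v] & connected_set G S].

Lemma mono_component_max G w v :
  maxset (mono_connected G w v) (mono_component G w v).
Proof.
set r := [rel a b | G a b && (w a == w b)].
have symr : connect_sym r.
  by apply: sym_connect_sym => a b /=; rewrite adj_sym eq_sym.
apply/maxsetP; split.
  apply/and3P; split; first by rewrite inE connect0.
    apply/forall_inP => u; rewrite inE => /connectP[p + ->].
    elim: p v => [|b p IHp] a //= /andP[/andP[_ /eqP ->]].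
    exact: IHp.
  apply/forall_inP => x xS; apply/forall_inP => y yS.
  have: connect r x y.
    move: xS yS; rewrite !inE -/r => vx vy.
    by apply: connect_trans vy; rewrite symr.
  case/connectP=> p rp ->{y yS}; elim: p x xS rp => [|b p IHp] a aS /=.
    by rewrite connect0.
  case/andP=> rab rp; have bS : b \in mono_component G w v.
    by move: aS; rewrite !inE -/r => va; apply: connect_trans va _; apply: connect1.
  apply: connect_trans (IHp b bS rp); apply: connect1 => /=.
  by rewrite aS bS; case/andP: rab.
move=> S /and3P[vS /forall_inP monoS connS] subS.
apply/eqP; rewrite eqEsubset subS andbT; apply/subsetP=> u uS; rewrite inE.
have /forall_inP/(_ u uS) := forall_inP connS v vS.
apply: connect_sub => a b /= /and3P[aS bS Gab]; apply: connect1 => /=.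
by rewrite Gab (eqP (monoS a aS)) eq_sym monoS.
Qed.

Definition play G w (m : V * C) : {ffun V -> C} :=
  [ffun u => if u \in mono_component G w m.1 then m.2 else w u].

Definition play_seq G w (s : seq (V * C)) := foldl (play G) w s.

Definition floods G w d (s : seq (V * C)) :=
  [forall u, play_seq G w s u == d].

Definition flood_in G w d (n : nat) :=
  exists2 s : seq (V * C), size s = n & floods G w d s.

Lemma floodable G w d : exists n, `[< flood_in G w d n >].
Proof.
set s := [seq (v, d) | v <- enum V]; exists (size s); apply/asboolP.
exists s => //; apply/forallP=> u; rewrite /s.
have : u \in enum V by rewrite mem_enum.
have keep l : forall w', w' u = d ->
    play_seq G w' [seq (v, d) | v <- l] u = d.
  elim: l => [|v l IHl] w' //= w'u; apply: IHl.
  by rewrite ffunE w'u if_same.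
elim: (enum V) w => [|v l IHl] w' //=; rewrite inE => /predU1P[<-|/IHl//].
by apply/eqP/keep; rewrite ffunE inE connect0.
Qed.

Definition min_moves G w d : nat := ex_minn (floodable G w d).

End FloodFilling.

Definition is_minimum (A : nat -> Prop) (n : nat) :=
  A n /\ forall k, A k -> n <= k.

(* Main.v *)
(** Say that a connected set A is assembled in colour d with n repaintings when
    it is a vertex of colour d (n = 0), or the disjoint union of two adjacent
    sets assembled in colour d (the costs add up), or a set assembled in another
    colour and then repainted (cost + 1).  Each join consumes a single edge, so
    an assembly of V only uses the edges of a spanning tree, and an assembly in a
    subgraph of G is one in G.  It thus suffices that, in every connected graph,
    min_moves is the least cost of an assembly of V.  Both inequalities rest on
    one normalization: a monochromatic component may be taken as a single piece
    instead of vertex by vertex, at no extra cost.  Then the first move of a game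
    is one repainting of a piece, and an innermost repainting is one move. *)
Require Import Defs.
From mathcomp Require Import all_boot.
From mathcomp Require Import boolp zify.

Set Implicit Arguments.
Unset Strict Implicit.
Unset Printing Implicit Defensive.

Section Assembly.

Variables (V : finType) (C : eqType).
Implicit Types (G T : sgraph V) (w : {ffun V -> C}) (f : V -> V).
Implicit Types (A B X : {set V}) (c d : C).

Definition block f x : {set V} := [set y | f y == f x].

Lemma mem_block f x : x \in block f x.
Proof. by rewrite inE. Qed.

(* The initial pieces are the fibres of [f]: single vertices for [f = id]. *)
Inductive assembles G w f : {set V} -> C -> nat -> Prop :=
| AsmLeaf x : assembles G w f (block f x) (w x) 0
| AsmJoin A B d m n x y : [disjoint A & B] -> x \in A -> y \in B -> G x y ->
    assembles G w f A d m -> assembles G w f B d n ->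
    assembles G w f (A :|: B) d (m + n)
| AsmPaint A c d n : assembles G w f A c n -> assembles G w f A d n.+1.

Definition respects f w := forall x y, f x = f y -> w x = w y.

Lemma assembles_sub G T w f A d n :
  subrel T G -> assembles T w f A d n -> assembles G w f A d n.
Proof.
move=> sTG; elim=> {A d n} [x|A B d m n x y dAB xA yB Txy _ hA _ hB|A c d n _ h].
- exact: AsmLeaf.
- exact: AsmJoin dAB xA yB (sTG _ _ Txy) hA hB.
- exact: AsmPaint h.
Qed.

(** Leaves are whole blocks, so every assembled set is a union of blocks. *)
Lemma assembles_saturated G w f A d n x y :
  assembles G w f A d n -> f x = f y -> x \in A -> y \in A.
Proof.
move=> asmA fxy; elim: asmA => {A d n} [z|A B d m n a b _ _ _ _ _ IHA _ IHB|//].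
  by rewrite !inE fxy.
by rewrite !inE => /orP[/IHA->|/IHB->]; rewrite ?orbT.
Qed.

Lemma block_sub G w f A d n x :
  assembles G w f A d n -> x \in A -> block f x \subset A.
Proof.
move=> asmA xA; apply/subsetP => y; rewrite inE => /eqP fyx.
exact: assembles_saturated asmA (esym fyx) xA.
Qed.

(** * Gluing two assemblies that overlap in one block *)

Section Merge.

Variables (G : sgraph V) (w : {ffun V -> C}) (f : V -> V).
Hypothesis fw : respects f w.

(** Lets an induction through a join go down into the side that contains [z]: this side is a union
    of blocks, so it holds the whole overlap. *)
Lemma split_overlap A B X d m z :
    [disjoint A & B] -> assembles G w f A d m -> z \in A ->
    X :&: (A :|: B) = block f z ->
  X :&: A = block f z /\ [disjoint X :|: A & B].
Proof.
move=> dAB asmA zA XAB; have zsub := block_sub asmA zA.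
have notB y : y \in A -> y \in B -> False.
  by move=> yA yB; move: (disjointFr dAB yA); rewrite yB.
split.
  apply/setP => y; rewrite -XAB !inE; apply: andb_id2l => yX.
  have [//|yNA] := boolP (y \in A); have [yB|//] := boolP (y \in B).
  by move: yNA; rewrite (subsetP zsub) // -XAB !inE yX yB orbT.
rewrite -setI_eq0; apply/eqP/setP => y; rewrite !inE; apply/negP.
case/andP=> /orP[yX|yA] yB; last exact: notB yA yB.
by apply: (notB y) => //; apply: (subsetP zsub); rewrite -XAB !inE yX yB orbT.
Qed.

(** [X] takes the place of the leaf [block f z]: both have colour [w z], so every later step of the
    assembly of [A] still applies. *)
Lemma assembles_plug A X d n k z :
    assembles G w f A d n -> z \in A -> assembles G w f X (w z) k ->
    X :&: A = block f z ->
  assembles G w f (X :|: A) d (k + n).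
Proof.
move=> asmA; elim: asmA X z k => {A d n}
  [x|A B d m n x y dAB xA yB Gxy asmA IHA asmB IHB|A c d n _ IH] X z k zA asmX.
- move: zA; rewrite inE => /eqP fzx; rewrite -(fw fzx) addn0.
  have -> : block f z = block f x by apply/setP => y; rewrite !inE fzx.
  by move/setIidPr/setUidPl->.
- move: zA; rewrite inE => /orP[zA|zB] XAB.
    have [XA dXAB] := split_overlap dAB asmA zA XAB.
    rewrite setUA addnA; apply: AsmJoin dXAB _ yB Gxy (IHA _ _ _ zA asmX XA) asmB.
    by rewrite inE xA orbT.
  rewrite disjoint_sym in dAB; rewrite setUC in XAB.
  have [XB dXBA] := split_overlap dAB asmB zB XAB.
  rewrite [A :|: B]setUC setUA [m + n]addnC addnA.
  rewrite adj_sym in Gxy.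
  apply: AsmJoin dXBA _ xA Gxy (IHB _ _ _ zB asmX XB) asmA.
  by rewrite inE yB orbT.
- by move=> XA; rewrite addnS; apply: AsmPaint (IH _ _ _ zA asmX XA).
Qed.

(* Following the block of [z] in the assembly of [A]: just before its first
   repainting, what it has become still has colour [w z] and can be plugged into
   [B] in its place; the rest of the assembly of [A] is then resumed, whatever
   the colour of [B].  If it is never repainted, then [d = w z]. *)
Lemma assembles_absorb A B d d' m n z :
    assembles G w f A d m -> assembles G w f B d' n -> z \in A ->
    B :&: A = block f z ->
  assembles G w f (B :|: A) d (n + m) \/ d = w z.
Proof.
move=> asmA asmB; elim: asmA z => {A d m}
  [x|A A' d m m' x y dAA xA yA' Gxy asmA IHA asmA' IHA'|A c d m asmA IH] z zA.
- by move: zA; rewrite inE => /eqP/fw->; right.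
- move: zA; rewrite inE => /orP[zA|zA'] BA.
    have [BA1 dBA] := split_overlap dAA asmA zA BA.
    case: (IHA _ zA BA1) => [asmBA|]; [left|by right].
    rewrite setUA addnA; apply: AsmJoin dBA _ yA' Gxy asmBA asmA'.
    by rewrite inE xA orbT.
  rewrite disjoint_sym in dAA; rewrite setUC in BA.
  have [BA1 dBA] := split_overlap dAA asmA' zA' BA.
  case: (IHA' _ zA' BA1) => [asmBA|]; [left|by right].
  rewrite [A :|: A']setUC setUA [m + m']addnC addnA; rewrite adj_sym in Gxy.
  apply: AsmJoin dBA _ xA Gxy asmBA asmA.
  by rewrite inE yA' orbT.
- move=> BA; left; rewrite addnS; case: (IH _ zA BA) => [|cz].
    exact: AsmPaint.
  apply: (@AsmPaint _ _ _ _ d'); rewrite setUC addnC.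
  apply: (@assembles_plug _ _ _ _ _ z) => //; last by rewrite setIC.
    by move: (mem_block f z); rewrite -BA inE => /andP[].
  by rewrite -cz.
Qed.

(** Either [A] absorbs [B], or [d = w z] and [A] itself can be plugged into [B] in place of the
    shared block. *)
Lemma assembles_merge A B d m n z :
    assembles G w f A d m -> assembles G w f B d n -> z \in A ->
    A :&: B = block f z ->
  assembles G w f (A :|: B) d (m + n).
Proof.
move=> asmA asmB zA AB; have BA : B :&: A = block f z by rewrite setIC.
have [|dz] := assembles_absorb asmA asmB zA BA; first by rewrite setUC addnC.
apply: (@assembles_plug _ _ _ _ _ z) => //; last by rewrite -dz.
by move: (mem_block f z); rewrite -AB inE => /andP[].
Qed.

End Merge.

(** * Coarsening the initial pieces *)

Section Coarsen.

Variables (G : sgraph V) (w : {ffun V -> C}) (f : V -> V) (u v : V).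
Hypotheses (fw : respects f w) (wuv : w u = w v).

(** Redirecting a value keeps pieces encoded as fibres, and drops [f u] from the image when
    [f u != f v]. *)
Definition identify x := if f x == f u then f v else f x.

Lemma respects_identify : respects identify w.
Proof.
move=> x y; rewrite /identify; case: eqP => [/fw->|_]; case: eqP => [/fw->|_] //.
- by move/fw <-.
- by move/fw ->.
- exact: fw.
Qed.

Lemma mem_block_identify x : (x \in block identify v) = (f x == f u) || (f x == f v).
Proof. by rewrite inE /identify if_same; case: (f x =P f u) => //=; rewrite eqxx. Qed.

(* Two sets sharing only the identified block are still joined at the same cost,
   by [assembles_merge]. *)
Lemma assembles_identify A d n :
    assembles G w f A d n ->
  assembles G w identify
    (if [disjoint A & block identify v] then A else A :|: block identify v) d n.
Proof.
set Z := block identify v.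
elim=> {A d n} [x|A B d m n x y dAB xA yB Gxy _ IHA _ IHB|A c d n _ IH].
- have [xZ|xNZ] := boolP (x \in Z).
    have -> : [disjoint block f x & Z] = false.
      by apply/negP=> /pred0P/(_ x); rewrite /= inE eqxx xZ.
    have -> : block f x :|: Z = Z.
      apply/setUidPr/subsetP => y; rewrite inE => /eqP fyx.
      by move: xZ; rewrite !mem_block_identify fyx.
    have -> : w x = w v.
      by move: xZ; rewrite mem_block_identify => /orP[] /eqP/fw->.
    exact: AsmLeaf.
  rewrite ifT; last first.
    rewrite -setI_eq0; apply/eqP/setP=> y; rewrite 2![in LHS]inE in_set0; apply/negP.
    case/andP=> /eqP fyx yZ; move: xNZ yZ.
    by rewrite !mem_block_identify fyx => /negPf->.
  suff -> : block f x = block identify x by apply: AsmLeaf.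
  apply/setP=> y; rewrite !inE /identify.
  move: xNZ; rewrite mem_block_identify negb_or => /andP[/negPf fxu /negPf fxv].
  by rewrite fxu; case: (f y =P f u) => // ->; rewrite ![_ == f x]eq_sym fxu fxv.
- rewrite -setI_eq0 setIUl setU_eq0 !setI_eq0 -/Z.
  move: IHA IHB; have [dAZ|nAZ] := boolP [disjoint A & Z];
    have [dBZ|nBZ] := boolP [disjoint B & Z] => /= IHA IHB.
  + exact: AsmJoin dAB xA yB Gxy IHA IHB.
  + rewrite -setUA; apply: AsmJoin xA _ Gxy IHA IHB; last by rewrite inE yB.
    by rewrite -setI_eq0 setIUr setU_eq0 !setI_eq0 dAB.
  + rewrite setUAC; apply: AsmJoin _ yB Gxy IHA IHB; last by rewrite inE xA.
    by rewrite -setI_eq0 setIUl setU_eq0 !setI_eq0 dAB disjoint_sym.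
  + rewrite setUUl; apply: (assembles_merge respects_identify IHA IHB (z := v)).
      by rewrite !inE eqxx orbT.
    by rewrite -setUIl disjoint_setI0 // set0U.
- exact: AsmPaint IH.
Qed.

End Coarsen.

(** * Monochromatic components as pieces *)

Section MonoComponents.

Variables (G : sgraph V) (w : {ffun V -> C}).

Lemma mem_mono_component v : v \in mono_component G w v.
Proof. by rewrite inE connect0. Qed.

Lemma mono_component_eq u v :
  u \in mono_component G w v -> mono_component G w u = mono_component G w v.
Proof.
rewrite inE => vu; apply/setP => x; rewrite !inE.
have sym : connect_sym [rel a b | G a b && (w a == w b)].
  by apply: sym_connect_sym => a b /=; rewrite adj_sym eq_sym.
by rewrite -(same_connect sym vu).
Qed.

Lemma mono_component_step x y :
  G x y -> w x = w y -> y \in mono_component G w x.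
Proof. by move=> Gxy wxy; rewrite inE connect1 //= Gxy wxy eqxx. Qed.

Lemma mono_component_colour u v : u \in mono_component G w v -> w u = w v.
Proof.
have /maxsetp/and3P[_ /forall_inP mono _] := mono_component_max G w v.
by move/mono/eqP.
Qed.

Lemma mono_component_connected v : connected_set G (mono_component G w v).
Proof. by have /maxsetp/and3P[] := mono_component_max G w v. Qed.

End MonoComponents.

Lemma connect_exit (r : rel V) A x y :
  connect r x y -> x \in A -> y \notin A ->
  exists a b, [/\ a \in A, b \notin A & r a b].
Proof.
case/connectP => p + ->; elim: p x => [|b p IH] a /=; first by move=> _ ->.
case/andP=> rab rp aA; have [bA|bNA _] := boolP (b \in A); first exact: IH.
by exists a, b.
Qed.

Lemma connected_setP G A x y : connected_set G A -> x \in A -> y \in A ->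
  connect [rel a b | [&& a \in A, b \in A & G a b]] x y.
Proof. by move=> /forall_inP cA xA yA; have /forall_inP/(_ y yA) := cA x xA. Qed.

Lemma connected_graph_setT G : connected_graph G -> connected_set G [set: V].
Proof.
move=> cG; apply/forall_inP => x _; apply/forall_inP => y _.
by rewrite (@eq_connect _ _ G) // => a b /=; rewrite !inE.
Qed.

Lemma block_id x : block id x = [set x].
Proof. by apply/setP => y; rewrite !inE. Qed.

Lemma assembles_set1 G w x : assembles G w id [set x] (w x) 0.
Proof. by rewrite -block_id; apply: AsmLeaf. Qed.

(** The missing vertices already have colour [d], so they join one at a time, for free, along edges
    leaving the current set. *)
Lemma assembles_grow G w A B d n z :
    assembles G w id A d n -> z \in A -> A \subset B -> connected_set G B ->
    {in B, forall x, x \notin A -> w x = d} ->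
  assembles G w id B d n.
Proof.
have [k] := ubnP #|B :\: A|; elim: k A => // k IH A ltk asmA zA sAB cB wB.
have [BA|/subsetPn[y yB yNA]] := boolP (B \subset A).
  by have <- : A = B by apply/eqP; rewrite eqEsubset sAB.
have zB := subsetP sAB _ zA.
have [a [b [aA bNA /and3P[aB bB Gab]]]] :=
  connect_exit (connected_setP cB zB yB) zA yNA.
apply: (IH (A :|: [set b])).
- rewrite -ltnS; apply: leq_trans ltk; rewrite ltnS; apply: proper_card.
  apply/properP; split; first by apply: setDS; apply: subsetUl.
  by exists b; rewrite !inE ?eqxx ?orbT // bNA.
- rewrite -[n]addn0; apply: (AsmJoin (x := a) (y := b)) => //.
  + by rewrite disjoint_sym disjoints1.
  + by rewrite inE.
  + by rewrite -(wB b bB bNA); apply: assembles_set1.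
- by rewrite inE zA.
- by rewrite subUset sAB sub1set.
- by [].
- by move=> x xB; rewrite inE negb_or => /andP[xNA _]; apply: wB.
Qed.

Lemma assembles_constant G w A d x :
    x \in A -> connected_set G A -> {in A, forall y, w y = d} ->
  assembles G w id A d 0.
Proof.
move=> xA cA wA; apply: (@assembles_grow _ _ [set x] _ _ _ x) => //.
- by rewrite -(wA x xA); apply: assembles_set1.
- by rewrite inE.
- by rewrite sub1set.
- by move=> y yA _; apply: wA.
Qed.

Definition refines f G w :=
  forall x y, f x = f y -> mono_component G w x = mono_component G w y.

(** Distinct blocks linked by a monochromatic edge are identified until none remain; the fibres are
    then the components. Each identification shrinks the image of [f]. *)
Lemma assembles_components G w f d n :
    refines f G w -> assembles G w f setT d n ->
  exists2 g : V -> V, block g =1 mono_component G w & assembles G w g setT d n.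
Proof.
have [k] := ubnP #|f @: setT|; elim: k f => // k IH f ltk rf asm.
have fw : respects f w.
  move=> x y /rf cxy; apply: (@mono_component_colour G).
  by rewrite -cxy; apply: mem_mono_component.
have [ex|nex] := boolP [exists u, exists v, [&& G u v, w u == w v & f u != f v]].
  have /existsP[u /existsP[v /and3P[Guv /eqP wuv nfuv]]] := ex.
  have cuv := mono_component_eq (mono_component_step Guv wuv).
  apply: (IH (identify f u v)).
  - rewrite -ltnS; apply: leq_trans ltk; rewrite ltnS; apply: proper_card.
    apply/properP; split.
      apply/subsetP => _ /imsetP[x _ ->]; rewrite /identify.
      by case: ifP => _; apply: imset_f.
    exists (f u); first exact: imset_f.
    apply/negP => /imsetP[x _ /esym]; rewrite /identify.
    by have [_ /esym/eqP|/eqP nfx //] := eqVneq (f x) (f u); rewrite (negPf nfuv).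
  - move=> x y; rewrite /identify.
    by case: eqP => [/rf->|_]; case: eqP => [/rf->|_] // /rf; rewrite ?cuv.
  - have := assembles_identify fw wuv asm.
    by case: ifP => // _; rewrite setTU.
exists f => // x; apply/setP => y; rewrite [LHS]inE.
apply/eqP/idP => [/rf <-|]; first exact: mem_mono_component.
rewrite inE => /connectP[p + ->]; elim: p x => //= z p IHp x.
case/andP=> /andP[Gxz wxz] /IHp->; apply/esym/eqP.
move: nex; rewrite negb_exists => /forallP/(_ x).
by rewrite negb_exists => /forallP/(_ z); rewrite Gxz wxz negbK.
Qed.

(** * Translation between games and assemblies *)

Lemma mono_component_play G w v c :
  mono_component G w v \subset mono_component G (play G w (v, c)) v.
Proof.
apply/subsetP => u uv; rewrite inE.
have := connected_setP (mono_component_connected G w v) (mem_mono_component G w v) uv.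
apply: connect_sub => a b /and3P[av bv Gab]; apply: connect1.
by rewrite /= Gab !ffunE /= av bv eqxx.
Qed.

(* Undoing the move costs a single repainting because the pieces are disjoint, so
   that exactly one of them contains [v]. *)
Lemma assembles_before_play G w v c g A d n :
    block g =1 mono_component G (play G w (v, c)) ->
    assembles G (play G w (v, c)) g A d n ->
  assembles G w id A d (n + (v \in A)).
Proof.
set w' := play G w (v, c) => gE.
elim=> {A d n} [x|A B d m n x y dAB xA yB Gxy _ IHA _ IHB|A a d n _ IH].
- rewrite gE add0n; have cA := mono_component_connected G w' x.
  have colA y : y \in mono_component G w' x -> w' y = w' x.
    exact: mono_component_colour.
  have sub := mono_component_play G w v c.
  have vv := mem_mono_component G w v.
  have [vA|vNA] := boolP (v \in mono_component G w' x).
    have <- : c = w' x by rewrite -(colA v vA) ffunE vv.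
    (* The old component of [v] is built for free and repainted in [c]; the other vertices of the
       new one had colour [c] before the move. *)
    apply: (assembles_grow (A := mono_component G w v) (z := v)) => //.
    + apply: (@AsmPaint _ _ _ _ (w v)).
      apply: (@assembles_constant _ _ _ _ v) => //.
        exact: mono_component_connected.
      by move=> y /mono_component_colour.
    + by rewrite -(mono_component_eq vA).
    + move=> y /colA; rewrite -(colA v vA) !ffunE vv => + /negPf yv.
      by rewrite yv.
  (* A component that avoids [v] misses the played set, so its colours are those of [w]. *)
  apply: (@assembles_constant _ _ _ _ x) => //; first exact: mem_mono_component.
  move=> y yA; rewrite -(colA y yA) ffunE ifN //.
  apply: contra vNA => yv; rewrite -(mono_component_eq yA).
  rewrite (mono_component_eq (subsetP sub _ yv)); exact: mem_mono_component.
- have -> : m + n + (v \in A :|: B) = m + (v \in A) + (n + (v \in B)).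
    rewrite addnACA; congr (_ + _); rewrite inE.
    by have [vA|//] := boolP (v \in A); rewrite (disjointFr dAB vA).
  exact: AsmJoin dAB xA yB Gxy IHA IHB.
- exact: AsmPaint IH.
Qed.

Lemma refines_id G w : refines id G w.
Proof. by move=> x y ->. Qed.

(** Induction on the game: the assembly for the remaining moves is coarsened to components, then the
    first move is undone. *)
Lemma floods_assembles G w d s (x : V) : connected_graph G ->
  floods G w d s -> assembles G w id setT d (size s).
Proof.
move=> cG; elim: s w => [|[v c] s IH] w /= /forallP fl.
  apply: (@assembles_constant _ _ _ _ x) => //; first exact: connected_graph_setT.
  by move=> y _; apply/eqP/fl.
have /IH/(assembles_components (@refines_id _ _)) : floods G (play G w (v, c)) d s.
  exact/forallP.
by case=> g gE /(assembles_before_play gE); rewrite inE addn1.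
Qed.

(* Two adjacent components have different colours, so nothing can be joined before
   a first repainting, which acts on exactly one component: it is a legal move. *)
Lemma assembles_play G w g A d n :
    block g =1 mono_component G w -> assembles G w g A d n ->
  (exists2 x, A = mono_component G w x & d = w x /\ n = 0) \/
  exists v c, [/\ n > 0, mono_component G w v \subset A &
                  assembles G (play G w (v, c)) id A d n.-1].
Proof.
move=> gE.
(* The move does not recolour [B], so each of its leaves is rebuilt from single vertices at no
   cost. *)
have untouched v c B e k : mono_component G w v \subset ~: B ->
    assembles G w g B e k -> assembles G (play G w (v, c)) id B e k.
  move=> vB asmB; elim: asmB vB => {B e k}
    [x|B B' e m k x y dB xB yB' Gxy _ IHB _ IHB'|B a e k _ IH] vB.
  - rewrite gE in vB *; apply: (@assembles_constant _ _ _ _ x).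
    + exact: mem_mono_component.
    + exact: mono_component_connected.
    + move=> y yx; rewrite ffunE -(mono_component_colour yx) ifN //.
      by apply/negP => /(subsetP vB); rewrite inE yx.
  - rewrite setCU subsetI in vB; have [{}vB vB'] := andP vB.
    exact: AsmJoin dB xB yB' Gxy (IHB vB) (IHB' vB').
  - exact: AsmPaint (IH vB).
elim=> {A d n} [x|A B d m n x y dAB xA yB Gxy asmA IHA asmB IHB|A a d n asmA IH].
- by left; exists x.
- have sAB : A \subset ~: B by rewrite -disjoints_subset.
  have sBA : B \subset ~: A by rewrite -disjoints_subset disjoint_sym.
  case: IHA => [[a Aa [da m0]]|[v [c [m_gt0 vA asmA']]]].
    case: IHB => [[b Bb [db n0]]|[v [c [n_gt0 vB asmB']]]].
      have /(mono_component_step Gxy) : w x = w y.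
        rewrite (mono_component_colour (G := G) (v := a)) -?Aa // -da db; apply/esym.
        by rewrite (mono_component_colour (G := G) (v := b)) -?Bb.
      rewrite Aa in xA; rewrite (mono_component_eq xA) -Aa => yA.
      by rewrite (disjointFr dAB yA) in yB.
    right; exists v, c; split; first by rewrite addn_gt0 n_gt0 orbT.
      by apply: subset_trans vB _; apply: subsetUr.
    have -> : (m + n).-1 = m + n.-1 by lia.
    apply: AsmJoin dAB xA yB Gxy (untouched _ _ _ _ _ _ asmA) asmB'.
    exact: subset_trans vB sBA.
  right; exists v, c; split; first by rewrite addn_gt0 m_gt0.
    by apply: subset_trans vA _; apply: subsetUl.
  have -> : (m + n).-1 = m.-1 + n by lia.
  apply: AsmJoin dAB xA yB Gxy asmA' (untouched _ _ _ _ _ _ asmB).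
  exact: subset_trans vA sAB.
(* Repainting the component of [x] is the move [(x, d)]; otherwise the move found earlier in the
   assembly is kept. *)
- right; case: IH => [[x -> [_ ->]]|[v [c [n_gt0 vA asmA']]]].
    exists x, d; split => //=; apply: (@assembles_constant _ _ _ _ x).
    + exact: mem_mono_component.
    + exact: mono_component_connected.
    + by move=> y yx; rewrite ffunE yx.
  exists v, c; split=> //=; rewrite -(prednK n_gt0); exact: AsmPaint asmA'.
Qed.

(** Induction on the cost: [assembles_play] extracts a first move and leaves an assembly that is
    cheaper by one. *)
Lemma assembles_floods G w d n : assembles G w id setT d n ->
  exists2 s, size s <= n & floods G w d s.
Proof.
elim: n w => [|n IH] w /(assembles_components (@refines_id _ _)) [g gE].
  case/(assembles_play gE) => [[x Tx [dx _]]|[v [c []//]]].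
  exists [::] => //; apply/forallP => y; apply/eqP.
  by rewrite dx; apply: (@mono_component_colour G); rewrite -Tx inE.
case/(assembles_play gE) => [[x _ []//]|[v [c [_ _ /= /IH[s sn fs]]]]].
by exists ((v, c) :: s).
Qed.

Lemma min_moves_le G w d s : floods G w d s -> min_moves G w d <= size s.
Proof.
rewrite /min_moves; case: ex_minnP => m _ minm fs; apply: minm.
by apply/asboolP; exists s.
Qed.

Lemma min_moves_assembles G w d (x : V) : connected_graph G ->
  assembles G w id setT d (min_moves G w d).
Proof.
move=> cG; rewrite /min_moves; case: ex_minnP => m /asboolP[s <- fs] _.
exact: floods_assembles fs.
Qed.

Lemma assembles_min_moves G w d n :
  assembles G w id setT d n -> min_moves G w d <= n.
Proof. by case/assembles_floods => s sn /min_moves_le/leq_trans; apply. Qed.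

(** * Spanning trees from assemblies *)

Lemma assembles_connected T w A d n x y : assembles T w id A d n ->
  x \in A -> y \in A -> connect T x y.
Proof.
have symT : connect_sym T by apply: sym_connect_sym; apply: adj_sym.
move=> asmA; elim: asmA x y => {A d n}
  [z|A B d m n a b _ aA bB Tab _ IHA _ IHB|//] x y.
  by rewrite !inE => /eqP-> /eqP->; apply: connect0.
have cross u v : u \in A -> v \in B -> connect T u v.
  move=> uA vB; apply: connect_trans (IHA _ _ uA aA) _.
  exact: connect_trans (connect1 Tab) (IHB _ _ bB vB).
rewrite !inE => /orP[xA|xB] /orP[yA|yB]; [exact: IHA|exact: cross| |exact: IHB].
by rewrite symT; apply: cross.
Qed.

(* A simple cycle entering [B] through the edge [(x, y)] can only leave it through
   the same edge. *)
Lemma ucycle_bridge (e : rel V) B x y p :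
    y \in B -> x \notin B ->
    (forall a b, e a b -> a \in B -> b \notin B -> a = y /\ b = x) ->
  ucycle e [:: x, y & p] -> p = [::].
Proof.
move=> yB xNB exitB /andP[/=/andP[_]].
(* [y] is the only exit of [B], so a path from elsewhere in [B] that avoids [y] never reaches
   [x]. *)
have stuck q a : a \in B -> a != y -> x \notin q -> y \notin q ->
    ~~ path e a (rcons q x).
  elim: q a => [|b q IH] a aB nay /=.
    rewrite andbT => _ _; apply: contra nay => /exitB/(_ aB xNB)[->]//.
  rewrite !inE !negb_or => /andP[nxb xq] /andP[nyb yq]; rewrite negb_and.
  have [eab|//] := boolP (e a b); have [bB|bNB] := boolP (b \in B).
    by rewrite IH // eq_sym.
  by have [ay] := exitB _ _ eab aB bNB; rewrite ay eqxx in nay.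
case: p => //= z q /andP[eyz ezq] /and3P[].
rewrite !inE !negb_or => /and3P[nxy nxz xq] /andP[nyz yq] _.
have zB : z \in B.
  by apply/negPn/negP => /(exitB _ _ eyz yB)[_ zx]; rewrite zx eqxx in nxz.
by move: ezq; apply/contraTeq => _; apply: stuck; rewrite // eq_sym.
Qed.

Definition edgeless_rel : rel V := fun _ _ => false.

Lemma edgeless_sym : symmetric edgeless_rel. Proof. by []. Qed.

Lemma edgeless_irrefl : irreflexive edgeless_rel. Proof. by []. Qed.

Definition edgeless := SGraph edgeless_sym edgeless_irrefl.

Section Bridge.

Variables (T U : sgraph V) (x y : V).
Hypothesis nxy : x != y.

Definition bridge_rel : rel V := fun a b =>
  [|| T a b, U a b, (a == x) && (b == y) | (a == y) && (b == x)].

Lemma bridge_sym : symmetric bridge_rel.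
Proof.
move=> a b; rewrite /bridge_rel adj_sym (adj_sym U).
by congr [|| _, _ | _]; rewrite orbC; congr (_ || _); apply: andbC.
Qed.

Lemma bridge_irrefl : irreflexive bridge_rel.
Proof.
move=> a; rewrite /bridge_rel !adj_irrefl /= [X in _ || X]andbC orbb.
by apply: contraNF nxy => /andP[/eqP ax /eqP ay]; rewrite -ax -ay.
Qed.

Definition bridge := SGraph bridge_sym bridge_irrefl.

(** A cycle through the new edge has size 2 by [ucycle_bridge]; any other stays on one side, inside
    [T] or [U]. *)
Lemma acyclic_bridge A B :
    [disjoint A & B] -> x \in A -> y \in B ->
    (forall a b, T a b -> a \in A /\ b \in A) ->
    (forall a b, U a b -> a \in B /\ b \in B) ->
    acyclic_graph T -> acyclic_graph U ->
  acyclic_graph bridge.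
Proof.
move=> dAB xA yB TA UB acT acU c /andP[cyc uc].
have xNB : x \notin B by rewrite (disjointFr dAB).
have yNA : y \notin A by rewrite (disjointFl dAB).
(* Rotation puts a chosen edge of the cycle at its head, the form that [ucycle_bridge] expects. *)
have headed a b : a \in c -> next c a = b -> a != b ->
    exists2 p, size c = (size p).+2 & ucycle bridge [:: a, b & p].
  move=> ac; have [i [|b' p] rc] := rot_to ac.
    rewrite -(next_rot i uc) rc /= eqxx => ->; by rewrite eqxx.
  rewrite -(next_rot i uc) rc /= eqxx => <- _; exists p.
    by rewrite -(size_rot i) rc.
  by rewrite -rc /ucycle rot_cycle rot_uniq cyc.
have [/andP[xc /eqP nx]|nx] := boolP ((x \in c) && (next c x == y)).
  have [p ->] := headed x y xc nx nxy.
  move/(ucycle_bridge yB xNB) => -> // a b.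
  move=> /or4P[/TA[aA _]|/UB[_ ->]//|/andP[/eqP ax _]|/andP[/eqP-> /eqP->]//] aB.
  - by rewrite (disjointFr dAB aA) in aB.
  - by rewrite -ax aB in xNB.
have [/andP[yc /eqP ny]|ny] := boolP ((y \in c) && (next c y == x)).
  have [|p ->] := headed y x yc ny; first by rewrite eq_sym.
  move/(ucycle_bridge xA yNA) => -> // a b.
  move=> /or4P[/TA[_ ->]//|/UB[aB _]|/andP[/eqP-> /eqP->]//|/andP[/eqP ay _]] aA.
  - by rewrite (disjointFr dAB aA) in aB.
  - by rewrite -ay aA in yNA.
have {}cyc : cycle [rel a b | T a b || U a b] c.
  apply: cycle_from_next => // a ac /=.
  have /or4P[->//|->|/andP[/eqP ax nay]|/andP[/eqP ay nax]] := next_cycle cyc ac.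
  - by rewrite orbT.
  - by rewrite -ax ac nay in nx.
  - by rewrite -ay ac nax in ny.
have pathT p a : a \in A -> path [rel a b | T a b || U a b] a p -> path T a p.
  elim: p a => //= b p IH a aA /andP[/orP[Tab|/UB[aB _]]].
    by rewrite Tab; apply: IH; case: (TA _ _ Tab).
  by rewrite (disjointFr dAB aA) in aB.
have pathU p a : a \in B -> path [rel a b | T a b || U a b] a p -> path U a p.
  elim: p a => //= b p IH a aB /andP[/orP[/TA[aA _]|Uab]].
    by rewrite (disjointFr dAB aA) in aB.
  by rewrite Uab; apply: IH; case: (UB _ _ Uab).
case: c uc cyc {headed nx ny} => [//|a [//|b p]] uc cyc.
have [/TA[aA _]|/UB[aB _]] : T a b \/ U a b by apply/orP; case/andP: cyc.
- by apply: acT; rewrite /ucycle uc andbT; apply: pathT.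
- by apply: acU; rewrite /ucycle uc andbT; apply: pathU.
Qed.

End Bridge.

(** [T] collects the edges consumed by the joins. Keeping them inside [A] makes the two sides of a
    join disjoint, as [acyclic_bridge] requires. *)
Lemma assembles_tree G w A d n : assembles G w id A d n ->
  exists T, [/\ subrel T G, forall x y, T x y -> x \in A /\ y \in A,
                acyclic_graph T & assembles T w id A d n].
Proof.
elim=> {A d n}
  [x|A B d m n x y dAB xA yB Gxy _ [T [TG TA acT asmT]] _ [U [UG UB acU asmU]]
  |A c d n _ [T [TG TA acT asmT]]].
- exists edgeless; split=> //; last exact: AsmLeaf.
  by case=> [|? [|? ?]] // /andP[].
- have nxy : x != y by apply: contraTneq yB => <-; rewrite (disjointFr dAB xA).
  exists (bridge T U nxy); split.
  + move=> a b /or4P[/TG|/UG||] // /andP[/eqP-> /eqP->] //.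
    by rewrite adj_sym.
  + move=> a b; rewrite !inE => /or4P[/TA[-> ->]|/UB[-> ->]||]; rewrite ?orbT //.
      by move=> /andP[/eqP-> /eqP->]; rewrite xA yB orbT.
    by move=> /andP[/eqP-> /eqP->]; rewrite xA yB orbT.
  + exact: acyclic_bridge dAB xA yB TA UB acT acU.
  + apply: AsmJoin dAB xA yB _ (assembles_sub _ asmT) (assembles_sub _ asmU).
    * by rewrite /= /bridge_rel !eqxx /= !orbT.
    * by move=> a b Tab; rewrite /= /bridge_rel Tab.
    * by move=> a b Uab; rewrite /= /bridge_rel Uab orbT.
- by exists T; split=> //; apply: AsmPaint asmT.
Qed.

End Assembly.

Theorem theorem3p1 (V : finType) (C : eqType) (G : sgraph V)
    (w : {ffun V -> C}) (connG : connected_graph G) (d : C) :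
  is_minimum
    (fun n => exists2 T : sgraph V, spanning_tree G T & n = min_moves T w d)
    (min_moves G w d).
Proof.
(* Assembled sets are nonempty, so the graph without vertices, flooded by the empty game, is treated
   apart. *)
have [x _|V0] := pickP (@predT V); last first.
  have min0 T : min_moves T w d = 0.
    apply/eqP; rewrite -leqn0; apply: (@min_moves_le _ _ _ _ _ [::]).
    by apply/forallP => v; have := V0 v.
  split=> [|_ [T _ ->]]; last by rewrite !min0.
  exists G; rewrite ?min0 //; split=> //; split=> //.
  by case=> // v; have := V0 v.
have minG T : spanning_tree G T -> min_moves G w d <= min_moves T w d.
  case=> TG [connT _]; apply/assembles_min_moves/(assembles_sub TG).
  exact: min_moves_assembles.
split=> [|_ [T TG ->]]; last exact: minG.
(* The minimizing tree comes from an assembly whose cost is that of an optimal game on [G]. *)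
have [T [TG _ acT asmT]] := assembles_tree (min_moves_assembles w d x connG).
have treeT : spanning_tree G T.
  by split=> //; split=> // a b; apply: assembles_connected asmT _ _; rewrite inE.
by exists T => //; apply/eqP; rewrite eqn_leq minG // assembles_min_moves.
Qed.
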